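(* Let $k$ be a field of characteristic zero, $\theta\in k$, and let $A$ be a unital associative Rota–Baxter $k$-algebra of weight $\theta$ with unit $1$ and Rota–Baxter operator $R$; put $\widetilde R:=-\theta\,\mathrm{id}-R$. Fix $a\in A$ and define $U'_{n,\theta}=U'_{n,\theta}(a)$, $n\ge0$, by $U'_{0,\theta}:=\lambda a$ and $$U'_{n+1,\theta}:=\sum_{l>0}\frac{(-1)^l\,l}{(l+1)!}\,L_\rhd[U'_{n,\theta}]^{l}(U'_{n,\theta}),\qquad n\ge0.$$ Then the elements $$\hat X:=\exp\bigl(-\widetilde R(U'_{0,\theta})\bigr)\exp\bigl(-\widetilde R(U'_{1,\theta})\bigr)\exp\bigl(-\widetilde R(U'_{2,\theta})\bigr)\cdots,$$ $$\hat Y:=\cdots\exp\bigl(-R(U'_{2,\theta})\bigr)\exp\bigl(-R(U'_{1,\theta})\bigr)\exp\bigl(-R(U'_{0,\theta})\bigr)$$ of $A[[\lambda]]$ (infinite products being $\lambda$-adic limits of the finite partial products) solve, respectively, the equations $$\hat X=1-\lambda\widetilde R(a\hat X),\qquad \hat Y=1-\lambda R(\hat Y a).$$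
   Context: An associative Rota–Baxter algebra of weight $\theta$ is an associative $k$-algebra $A$ with a $k$-linear map $R:A\to A$ satisfying $R(x)R(y)=R\bigl(R(x)y+xR(y)+\theta xy\bigr)$ for all $x,y\in A$. The associated left pre-Lie product on $A$ is $x\rhd y:=R(x)y-yR(x)-\theta yx$; write $L_\rhd[x](y):=x\rhd y$, and $L_\rhd[x]^l$ for the $l$-fold iterate. $R$, $\widetilde R$ and $\rhd$ are extended $\lambda$-(bi)linearly to $A[[\lambda]]$. The exponential $\exp$ is the usual one in the unital algebra $A[[\lambda]]$. All $U'_{n,\theta}$ lie in $\lambda A[[\lambda]]$. *)

(* Defs.v *)
From HB Require Import structures.
From mathcomp Require Import all_boot all_order all_algebra.
From mathcomp Require Import boolp classical_sets.

Set Implicit Arguments.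
Unset Strict Implicit.
Unset Printing Implicit Defensive.

Import GRing.Theory.
Local Open Scope ring_scope.

(* [fps A] is A[[lambda]]: [u n] is the coefficient of lambda^n.  A record     *)
(* rather than an alias of [nat -> A], so that the pointwise ring structure on *)
(* functions cannot interfere with the Cauchy product.                         *)
Record fps (A : Type) := FPS { coeff : nat -> A }.
Coercion coeff : fps >-> Funclass.

Lemma fpsP (A : Type) (u v : fps A) : (forall n, u n = v n) <-> u = v.
Proof.
split=> [|-> //]; case: u => u; case: v => v /= uv.
by congr FPS; apply: functional_extensionality_dep.
Qed.

HB.instance Definition _ (A : Type) := gen_eqMixin (fps A).
HB.instance Definition _ (A : Type) := gen_choiceMixin (fps A).

(* The lambda-linear extension to A[[lambda]] of a linear map f on A, and the  *)
(* lambda-bilinear extension of a bilinear operation op on A.                  *)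
Definition fps_map (A B : Type) (f : A -> B) (u : fps A) : fps B :=
  FPS (fun n => f (u n)).

Definition fps_map2 (A : nmodType) (op : A -> A -> A) (u v : fps A) : fps A :=
  FPS (fun n => \sum_(i < n.+1) op (u i) (v (n - i)%N)).

Section Zmodule.
Variable A : zmodType.
Implicit Types u v w : fps A.

Definition fps_zero : fps A := FPS (fun=> 0).
Definition fps_add u v : fps A := FPS (fun n => u n + v n).
Definition fps_opp u : fps A := FPS (fun n => - u n).

Lemma fps_addA : associative fps_add.
Proof. by move=> u v w; apply/fpsP => n /=; rewrite addrA. Qed.
Lemma fps_addC : commutative fps_add.
Proof. by move=> u v; apply/fpsP => n /=; rewrite addrC. Qed.
Lemma fps_add0 : left_id fps_zero fps_add.
Proof. by move=> u; apply/fpsP => n /=; rewrite add0r. Qed.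
Lemma fps_addN : left_inverse fps_zero fps_opp fps_add.
Proof. by move=> u; apply/fpsP => n /=; rewrite addNr. Qed.

HB.instance Definition _ := GRing.isZmodule.Build (fps A)
  fps_addA fps_addC fps_add0 fps_addN.

Lemma coeff0 n : (0 : fps A) n = 0. Proof. by []. Qed.
Lemma coeffD u v n : (u + v) n = u n + v n. Proof. by []. Qed.
Lemma coeffN u n : (- u) n = - u n. Proof. by []. Qed.
Lemma coeffB u v n : (u - v) n = u n - v n. Proof. by []. Qed.
Lemma coeff_sum (I : Type) (r : seq I) (P : pred I) (F : I -> fps A) n :
  (\sum_(i <- r | P i) F i) n = \sum_(i <- r | P i) F i n.
Proof. exact: (big_morph (fun u : fps A => u n)). Qed.

End Zmodule.

Section Ring.
Variable A : nzRingType.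
Implicit Types u v w : fps A.

Definition fpsC (a : A) : fps A := FPS (fun n => if n is 0%N then a else 0).
Definition fps_mul u v : fps A := fps_map2 *%R u v.

Lemma fps_mulE u v n : fps_mul u v n = \sum_(i < n.+1) u i * v (n - i)%N.
Proof. by []. Qed.

Lemma fps_mul_rev u v n : fps_mul u v n = \sum_(i < n.+1) u (n - i)%N * v i.
Proof.
rewrite /= (reindex_inj rev_ord_inj) /=.
by apply: eq_bigr => i _; rewrite subSS subKn // -ltnS.
Qed.

Lemma fps_mulA : associative fps_mul.
Proof.
move=> u v w; apply/fpsP => n; rewrite [RHS]fps_mul_rev.
rewrite [LHS]fps_mulE.
pose c3 j k := u j * (v (n - j - k)%N * w k).
transitivity (\sum_(j < n.+1) \sum_(k < n.+1 | (k <= n - j)%N) c3 j k).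
  apply: eq_bigr => j _; rewrite fps_mul_rev big_distrr /=.
  by rewrite (big_ord_narrow_leq (leq_subr _ _)).
rewrite (exchange_big_dep predT) //=; apply: eq_bigr => k _.
transitivity (\sum_(j < n.+1 | (j <= n - k)%N) c3 j k).
  apply: eq_bigl => j; rewrite -ltnS -(ltnS j) -!subSn ?leq_ord //.
  by rewrite -subn_gt0 -(subn_gt0 j) -!subnDA addnC.
rewrite (big_ord_narrow_leq (leq_subr _ _)) big_distrl /=.
by apply: eq_bigr => j _; rewrite /c3 -!subnDA addnC mulrA.
Qed.

Lemma fps_mul1 : left_id (fpsC 1) fps_mul.
Proof.
move=> u; apply/fpsP => n /=; rewrite big_ord_recl /= mul1r subn0.
by rewrite big1 ?addr0 // => i _; rewrite mul0r.
Qed.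
Lemma fps_mulr1 : right_id (fpsC 1) fps_mul.
Proof.
move=> u; apply/fpsP => n; rewrite fps_mul_rev big_ord_recl /= mulr1 subn0.
by rewrite big1 ?addr0 // => i _; rewrite mulr0.
Qed.
Lemma fps_mulDl : left_distributive fps_mul +%R.
Proof.
move=> u v w; apply/fpsP => n /=; rewrite -big_split /=.
by apply: eq_bigr => i _; rewrite mulrDl.
Qed.
Lemma fps_mulDr : right_distributive fps_mul +%R.
Proof.
move=> u v w; apply/fpsP => n /=; rewrite -big_split /=.
by apply: eq_bigr => i _; rewrite mulrDr.
Qed.
Lemma fps_oner_neq0 : fpsC 1 != 0.
Proof.
by apply/eqP => /(congr1 (fun u : fps A => u 0%N)) /eqP; rewrite /= oner_eq0.
Qed.

HB.instance Definition _ := GRing.Zmodule_isNzRing.Build (fps A)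
  fps_mulA fps_mul1 fps_mulr1 fps_mulDl fps_mulDr fps_oner_neq0.

Definition lambda : fps A := FPS (fun n => (n == 1)%N%:R).

Lemma coeffM u v n : (u * v) n = \sum_(i < n.+1) u i * v (n - i)%N.
Proof. by []. Qed.
Lemma coeffM_rev u v n : (u * v) n = \sum_(i < n.+1) u (n - i)%N * v i.
Proof. exact: fps_mul_rev. Qed.
Lemma coeff1 n : (1 : fps A) n = (n == 0)%N%:R.
Proof. by case: n. Qed.

End Ring.

Section Algebra.
Variables (k : comNzRingType) (A : algType k).
Implicit Types (c : k) (u v : fps A).

Definition fps_scale c u : fps A := FPS (fun n => c *: u n).

Lemma fps_scaleA c d u : fps_scale c (fps_scale d u) = fps_scale (c * d) u.
Proof. by apply/fpsP => n /=; rewrite scalerA. Qed.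
Lemma fps_scale1 : left_id 1 fps_scale.
Proof. by move=> u; apply/fpsP => n /=; rewrite scale1r. Qed.
Lemma fps_scaleDr : right_distributive fps_scale +%R.
Proof. by move=> c u v; apply/fpsP => n /=; rewrite scalerDr. Qed.
Lemma fps_scaleDl u : {morph fps_scale^~ u : c d / c + d}.
Proof. by move=> c d; apply/fpsP => n /=; rewrite scalerDl. Qed.

HB.instance Definition _ := GRing.Zmodule_isLmodule.Build k (fps A)
  fps_scaleA fps_scale1 fps_scaleDr fps_scaleDl.

Lemma fps_scaleAl c u v : c *: (u * v) = c *: u * v.
Proof.
apply/fpsP => n; rewrite [LHS]/= scaler_sumr.
by apply: eq_bigr => i _; rewrite scalerAl.
Qed.
HB.instance Definition _ := GRing.Lmodule_isLalgebra.Build k (fps A) fps_scaleAl.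

Lemma fps_scaleAr c u v : c *: (u * v) = u * (c *: v).
Proof.
apply/fpsP => n; rewrite [LHS]/= scaler_sumr.
by apply: eq_bigr => i _; rewrite scalerAr.
Qed.
HB.instance Definition _ := GRing.Lalgebra_isAlgebra.Build k (fps A) fps_scaleAr.

Lemma coeffZ c u n : (c *: u) n = c *: u n. Proof. by []. Qed.

End Algebra.

Section Adic.
Variable A : zmodType.
Implicit Types (s : nat -> fps A) (x u : fps A).

(* u lies in lambda^n A[[lambda]] *)
Definition in_adic (n : nat) u := forall i, (i < n)%N -> u i = 0.

Definition adic_cvg s x :=
  forall n, exists N, forall m, (N <= m)%N -> in_adic n (s m - x).

(* The lambda-adic limit; the value 0 is used when there is none. *)
Definition adic_lim s : fps A := xget 0 [set x | adic_cvg s x].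

Lemma adic_cvg_unique s x y : adic_cvg s x -> adic_cvg s y -> x = y.
Proof.
move=> sx sy; apply/fpsP => n.
have [N sxN] := sx n.+1; have [M syM] := sy n.+1.
have := syM _ (leq_maxr N M) n (ltnSn n).
have := sxN _ (leq_maxl N M) n (ltnSn n).
rewrite !coeffB => /eqP; rewrite subr_eq0 => /eqP -> /eqP.
by rewrite subr_eq0 => /eqP.
Qed.

Lemma adic_limP s x : adic_cvg s x -> adic_cvg s (adic_lim s).
Proof.
by move=> sx; apply: (@xgetPex _ 0 [set y | adic_cvg s y]); exists x.
Qed.

Lemma adic_lim_unique s x : adic_cvg s x -> adic_lim s = x.
Proof. by move=> sx; apply: adic_cvg_unique (sx); apply: adic_limP sx. Qed.

Lemma adic_cvg_series (m : nat) (v : nat -> fps A) :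
    (forall l, in_adic l (v l)) ->
  adic_cvg (fun N => \sum_(m <= l < N) v l)
           (FPS (fun n => \sum_(m <= l < n.+1) v l n)).
Proof.
move=> vl n; exists n => N leN i ltin; rewrite coeffB coeff_sum /=.
apply/eqP; rewrite subr_eq0; apply/eqP.
have ltiN : (i.+1 <= N)%N by apply: leq_trans leN.
have [lemi | ltim] := leqP m i.+1; last first.
  rewrite [RHS]big_geq 1?ltnW //; rewrite big_seq big1 // => l.
  rewrite mem_index_iota => /andP[leml _].
  by apply: vl; apply: leq_trans leml; apply: ltnW.
rewrite (big_cat_nat lemi ltiN) /= -[RHS]addr0; congr (_ + _).
rewrite big_seq big1 // => l.
by rewrite mem_index_iota => /andP[ltil _]; apply: vl.
Qed.

End Adic.

Section RotaBaxter.
Variables (k : fieldType) (A : algType k) (theta : k) (R : A -> A).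
Implicit Types (x y a : A) (u v : fps A).

Definition rota_baxter :=
  forall x y, R x * R y = R (R x * y + x * R y + theta *: (x * y)).

Definition RB_tilde x : A := - (theta *: x) - R x.

Definition prelie x y : A := R x * y - y * R x - theta *: (y * x).

Definition fps_prelie u v : fps A := fps_map2 prelie u v.

Definition fps_exp u : fps A :=
  adic_lim (fun N => \sum_(0 <= l < N) (l`!%:R)^-1 *: u ^+ l).

(* One step of the Fer recursion: U'_(n+1) = fer_step U'_n. *)
Definition fer_step u : fps A :=
  adic_lim (fun N => \sum_(1 <= l < N)
    ((-1) ^+ l * l%:R / (l.+1)`!%:R) *: iter l (fps_prelie u) u).

Fixpoint fer_U a (n : nat) : fps A :=
  if n is n'.+1 then fer_step (fer_U a n') else lambda A * fpsC a.

Definition Xhat_part a (N : nat) : fps A :=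
  \prod_(0 <= n < N) fps_exp (- fps_map RB_tilde (fer_U a n)).

(* The factors are in decreasing order of the index, the one of index 0 being  *)
(* the rightmost.                                                              *)
Definition Yhat_part a (N : nat) : fps A :=
  \prod_(n <- rev (iota 0 N)) fps_exp (- fps_map R (fer_U a n)).

Definition Xhat a : fps A := adic_lim (Xhat_part a).
Definition Yhat a : fps A := adic_lim (Yhat_part a).

End RotaBaxter.

(* All the limits entering [fps_exp] and [fer_step] exist on lambda A[[lambda]], *)
(* which contains the U'_n.                                                     *)
Section WellDefined.
Variables (k : fieldType) (A : algType k) (theta : k) (R : {linear A -> A}).
Implicit Types (u v : fps A).

Lemma in_adicZ n (c : k) u : in_adic n u -> in_adic n (c *: u).
Proof. by move=> un i ltin; rewrite coeffZ un // scaler0. Qed.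

Lemma in_adic_map2 (op : A -> A -> A) m n u v :
    (forall x, op 0 x = 0) -> (forall x, op x 0 = 0) ->
  in_adic m u -> in_adic n v -> in_adic (m + n) (fps_map2 op u v).
Proof.
move=> op0x opx0 um vn i ltimn /=; apply: big1 => j _.
have [ltjm | lemj] := ltnP j m; first by rewrite um.
rewrite vn ?opx0 // ltn_subLR -1?ltnS //.
by apply: leq_trans ltimn _; rewrite leq_add2r.
Qed.

Lemma prelie0x x : prelie theta R 0 x = 0.
Proof. by rewrite /prelie linear0 mul0r !mulr0 scaler0 !subr0. Qed.

Lemma preliex0 x : prelie theta R x 0 = 0.
Proof. by rewrite /prelie mulr0 !mul0r scaler0 !subr0. Qed.

Lemma fps_prelieE u v : fps_prelie theta R u v =
  fps_map R u * v - v * fps_map R u - theta *: (v * u).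
Proof.
apply/fpsP => n; rewrite !coeffB coeffZ coeffM !coeffM_rev.
rewrite scaler_sumr -!sumrB; exact: eq_bigr.
Qed.

Lemma in_adicX u l : in_adic 1 u -> in_adic l (u ^+ l).
Proof.
move=> u1; elim: l => [//|l IHl]; rewrite exprS -add1n.
by apply: in_adic_map2 IHl => // x; rewrite (mul0r, mulr0).
Qed.

Lemma in_adic_iter u l : in_adic 1 u ->
  in_adic l.+1 (iter l (fps_prelie theta R u) u).
Proof.
move=> u1; elim: l => [//|l IHl] /=; rewrite -(add1n l.+1).
by apply: in_adic_map2 IHl => //; [apply: prelie0x | apply: preliex0].
Qed.

Lemma fps_exp_cvg u : in_adic 1 u ->
  adic_cvg (fun N => \sum_(0 <= l < N) (l`!%:R)^-1 *: u ^+ l) (fps_exp u).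
Proof.
move=> u1; apply/adic_limP/adic_cvg_series => l.
by apply/in_adicZ/in_adicX.
Qed.

Lemma fer_step_terms u l : in_adic 1 u -> in_adic l.+1
  (((-1) ^+ l * l%:R / (l.+1)`!%:R) *: iter l (fps_prelie theta R u) u).
Proof. by move=> u1; apply/in_adicZ/in_adic_iter. Qed.

Lemma fer_step_cvg u : in_adic 1 u ->
  adic_cvg (fun N => \sum_(1 <= l < N)
      ((-1) ^+ l * l%:R / (l.+1)`!%:R) *: iter l (fps_prelie theta R u) u)
    (fer_step theta R u).
Proof.
move=> u1; apply/adic_limP/adic_cvg_series => l i ltil.
by apply: fer_step_terms => //; apply: ltnW.
Qed.

Lemma fer_U_adic a n : in_adic 1 (fer_U theta R a n).
Proof.
elim: n => [|n IHn] [|//] _ /=.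
  by rewrite big_ord1 mul0r.
have [N /(_ N (leqnn N) 0%N isT)] := fer_step_cvg IHn 1.
rewrite coeffB coeff_sum big1 => [|l _].
  by rewrite sub0r => /eqP; rewrite oppr_eq0 => /eqP.
exact: fer_step_terms.
Qed.

End WellDefined.

(* Main.v *)
(* Put S = R + theta id = - RB_tilde, E = exp (S u), F = exp (R u).  The        *)
(* star product R x y + x S y is associative and sent by both R and S to the    *)
(* product of A[[lambda]], so the star exponential 1 + V of u has S V = E - 1   *)
(* and R V = F - 1.  For b = fer_step u, a binomial identity in the commuting   *)
(* left multiplication by R u and right multiplication by S u gives             *)
(* F b + V = u E.  Hence, if x = 1 + S (b x) up to an error e, then E x solves  *)
(* x = 1 + S (u x) up to the error E e - S (V e).  Descending through the Fer   *)
(* factors, the N-th partial product solves the equation for u = lambda a up to *)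
(* lambda^(N+1), because U'_N has order at least N + 1.  The equation for Y is  *)
(* treated in the same way, with b exp (- S u) = exp (- R u) u + V(- u).        *)
From HB Require Import structures.
Require Import Defs.
From mathcomp Require Import all_boot all_order all_algebra.

Set Implicit Arguments.
Unset Strict Implicit.
Unset Printing Implicit Defensive.

Import GRing.Theory.
Local Open Scope ring_scope.

(** Put u = lambda a. The equations read x = 1 + S(u x) and y = 1 - R(y u). The Rota-Baxter identity
    makes R and S homomorphisms from the star product to the ordinary one ([fps_RM], [fps_SM]), and
    L[u] is left multiplication by R u minus right multiplication by S u. Call these commuting
    multiplications p and q, and let D = q - p.

    Since the sum of l z^l / (l+1)! is e^z - (e^z - 1)/z, one Fer step is e^D - (e^D - 1)/D applied
    to u. Applying e^p and adding (e^q - e^p)/(q - p) u, which is the star exponential of u minus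
    its unit, gives e^q u ([exp_mul_fer]; [fer_mul_exp] is the analogue for the second equation).

    Hence x -> exp(S u) x and y -> y exp(- R u) carry solutions for the Fer step of u to solutions
    for u, with explicit control of the error ([X_defect], [Y_defect]). The empty product solves the
    N-th equation modulo lambda^(N+1), because U'_N has that order. Going back N steps keeps this
    precision ([X_prod_defect], [Y_prod_defect]), and the limit solves the first equation
    exactly. *)

(** * Binomial identities for two commuting operators *)

Section CommutingOperators.
Variables (k : nzRingType) (U : lmodType k) (p q : {linear U -> U}).

Lemma iter_linear n : linear (iter n p).
Proof. by move=> c x y; elim: n => //= n ->; rewrite linearP. Qed.

HB.instance Definition _ n :=
  GRing.isLinear.Build k U U *:%R (iter n p) (iter_linear n).

Hypothesis pq : forall x, p (q x) = q (p x).

Lemma iter_comm n x : iter n p (q x) = q (iter n p x).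
Proof. by elim: n => //= n ->; rewrite pq. Qed.

Variable D : U -> U.
Hypothesis DE : forall x, D x = q x - p x.

Lemma iter_binomial n x :
  iter n q x = \sum_(l < n.+1) iter (n - l) p (iter l D x) *+ 'C(n, l).
Proof.
elim: n => [|n IHn]; first by rewrite big_ord1.
have qE y : q y = p y + D y by rewrite DE addrC subrK.
rewrite iterS IHn linear_sum /=.
under eq_bigr => l _.
  rewrite linearMn -iter_comm qE linearD /= -iterSr -subSn ?leq_ord //.
  rewrite -iterS mulrnDl; over.
rewrite big_split /= [RHS]big_ord_recl /=.
under [X in _ = _ + X]eq_bigr => l _ do rewrite [bump 0 l]add1n binS mulrnDr.
rewrite big_split /= addrA; congr (_ + _).
rewrite [X in _ = _ + X]big_ord_recr /= (bin_small (ltnSn n)) mulr0n addr0.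
by rewrite [LHS]big_ord_recl /= !bin0.
Qed.

(** Both sides are (q^(n+1) - p^(n+1))/(q - p), on the left through q = p + D. Pascal's rule and
    induction avoid the division. *)
Lemma iter_telescope n x :
  \sum_(l < n.+1) iter (n - l) p (iter l D x) *+ 'C(n.+1, l.+1) =
  \sum_(i < n.+1) iter i p (iter (n - i) q x).
Proof.
elim: n => [|n IHn]; first by rewrite !big_ord1.
under eq_bigr => l _ do rewrite binS mulrnDr.
rewrite big_split /= -iter_binomial [RHS]big_ord_recl /= addrC; congr (_ + _).
rewrite big_ord_recr /= (bin_small (ltnSn n.+1)) mulr0n addr0.
under [RHS]eq_bigr => l _ do rewrite [bump 0 l]add1n subSS.
rewrite -linear_sum -IHn linear_sum; apply: eq_bigr => l _ /=.
by rewrite linearMn subSn ?leq_ord.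
Qed.

(** Degree n part of e^p (e^D - (e^D - 1)/D) + (e^q - e^p)/(q - p) = e^q, cleared of denominators.
    It rests on (l+1) C(n+1, l+1) = (n+1) C(n, l). *)
Lemma fer_binomial n x :
  \sum_(l < n.+1) iter (n - l) p (iter l D x) *+ ('C(n.+1, l.+1) * l) +
    \sum_(i < n.+1) iter i p (iter (n - i) q x) = iter n q x *+ n.+1.
Proof.
rewrite -iter_telescope -big_split /= iter_binomial -sumrMnl.
apply: eq_bigr => l _.
by rewrite -mulrnDr addnC -mulnS -mulrnA mulnC -mul_bin_diag mulnC.
Qed.

End CommutingOperators.

(** * Rearrangement of lambda-adically convergent series *)

Lemma big_triangle (V : nmodType) (g : nat -> nat -> V) (m : nat) :
    (forall i l, (m <= i + l)%N -> g i l = 0) ->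
  \sum_(i < m) \sum_(l < m) g i l = \sum_(n < m) \sum_(l < n.+1) g (n - l)%N l.
Proof.
move=> g0; rewrite exchange_big /=.
under [RHS]eq_bigr => n _ do
  rewrite (big_ord_widen m (fun l => g (n - l)%N l) (ltn_ord n)).
rewrite [RHS](exchange_big_dep predT) //=; apply: eq_bigr => l _.
transitivity (\sum_(l <= n < m) g (n - l)%N l); last first.
  rewrite (big_nat_widenl _ 0) // big_mkord. apply: eq_bigl => n.
  by rewrite ltnS.
rewrite -{2}[val l]add0n big_addn /=.
under [RHS]eq_bigr => i _ do rewrite addnK.
rewrite -(big_mkord xpredT (g^~ (val l))) /=.
rewrite (big_cat_nat (leq0n (m - l)) (leq_subr _ _)) /= [X in _ + X]big_nat.
rewrite [X in _ + X]big1 ?addr0 // => i /andP[lemi _]; apply: g0.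
by rewrite addnC -leq_subLR.
Qed.

Section AdicSums.
Variables (k : fieldType) (A : algType k).
Implicit Types (u v x y : fps A) (c : nat -> fps A) (T : fps A -> fps A).

Lemma in_adic_le m n u : (m <= n)%N -> in_adic n u -> in_adic m u.
Proof. by move=> lemn un i ltim; apply: un; apply: leq_trans lemn. Qed.

Lemma in_adicD n u v : in_adic n u -> in_adic n v -> in_adic n (u + v).
Proof. by move=> un vn i ltin; rewrite coeffD un ?vn ?addr0. Qed.

Lemma in_adicN n u : in_adic n u -> in_adic n (- u).
Proof. by move=> un i ltin; rewrite coeffN un ?oppr0. Qed.

Lemma in_adicB n u v : in_adic n u -> in_adic n v -> in_adic n (u - v).
Proof. by move=> un vn; apply/in_adicD/in_adicN. Qed.

Lemma in_adicM m n u v : in_adic m u -> in_adic n v -> in_adic (m + n) (u * v).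
Proof. by apply: in_adic_map2 => x; rewrite (mul0r, mulr0). Qed.

Lemma in_adic_eq u v : (forall n, in_adic n (u - v)) -> u = v.
Proof.
move=> uv; apply/eqP; rewrite -subr_eq0; apply/eqP/fpsP => n.
by rewrite (uv n.+1).
Qed.

(** Degree of an operator for the lambda-adic filtration. For a linear map, [raises 0] serves as
    lambda-adic continuity. *)
Definition raises n T := forall m x, in_adic m x -> in_adic (n + m) (T x).

Lemma raises_iter T n : raises 1 T -> raises n (iter n T).
Proof.
move=> T1 m x xm; elim: n => //= n IHn.
by rewrite addSn -add1n; apply: T1.
Qed.

Lemma raises_mulr m u : in_adic m u -> raises m (u \*o idfun).
Proof. by move=> um n x xn; apply: in_adicM. Qed.

Lemma raises_mull m u : in_adic m u -> raises m (u \o* idfun).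
Proof. by move=> um n x xn; rewrite addnC; apply: in_adicM. Qed.

(** The infinite sum of the [c l] once each [c l] has order at least l, as then no later term
    reaches degree n. *)
Definition fsum c : fps A := FPS (fun n => \sum_(l < n.+1) c l n).

Lemma fsum_cvg c : (forall l, in_adic l (c l)) ->
  adic_cvg (fun N => \sum_(0 <= l < N) c l) (fsum c).
Proof.
move=> /(adic_cvg_series 0); congr adic_cvg.
by apply/fpsP => n /=; rewrite big_mkord.
Qed.

Lemma in_adic_fsum n c : (forall l, in_adic n (c l)) -> in_adic n (fsum c).
Proof. by move=> cn i ltin /=; rewrite big1 // => l _; apply: cn. Qed.

Lemma eq_fsum c d : c =1 d -> fsum c = fsum d.
Proof. by move=> cd; apply/fpsP => n; apply: eq_bigr => l _; rewrite cd. Qed.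

Lemma fsumD c d : fsum c + fsum d = fsum (fun l => c l + d l).
Proof. by apply/fpsP => n; rewrite /= -big_split. Qed.

Lemma fsumS c : (forall l, in_adic l (c l)) ->
  fsum c = c 0%N + fsum (fun l => c l.+1).
Proof.
move=> cl; apply/fpsP => n; rewrite /= big_ord_recl; congr (_ + _).
by rewrite [RHS]big_ord_recr /= cl // addr0.
Qed.

Lemma fsum_trunc n c : (forall l, in_adic l (c l)) ->
  in_adic n (fsum c - \sum_(l < n) c l).
Proof.
move=> cl i ltin; rewrite coeffB coeff_sum /=.
rewrite -!(big_mkord xpredT (fun l => c l i)).
rewrite (big_cat_nat (leq0n i.+1) ltin) /=.
rewrite opprD addrA subrr sub0r big_nat big1 ?oppr0 // => l /andP[il _].
exact: cl.
Qed.

Lemma linear_coeff_fsum (T : {linear fps A -> fps A}) n c :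
    raises 0 T -> (forall l, in_adic l (c l)) ->
  T (fsum c) n = \sum_(l < n.+1) T (c l) n.
Proof.
move=> T0 cl; have /T0/(_ n (ltnSn n)) := @fsum_trunc n.+1 c cl.
rewrite linearB linear_sum coeffB coeff_sum => /eqP.
by rewrite subr_eq0 => /eqP.
Qed.

Lemma linear_fsum (T : {linear fps A -> fps A}) c :
    raises 0 T -> (forall l, in_adic l (c l)) ->
  T (fsum c) = fsum (T \o c).
Proof. by move=> T0 cl; apply/fpsP => n; apply: linear_coeff_fsum. Qed.

(** The i-th iterate of p on [c l] has order at least i + l, so each coefficient involves a finite
    triangle of terms, regrouped along i + l = n. *)
Lemma cauchy_fsum (p : {linear fps A -> fps A}) (a : nat -> k) c :
    raises 1 p -> (forall l, in_adic l (c l)) ->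
  fsum (fun n => a n *: iter n p (fsum c)) =
  fsum (fun n => \sum_(l < n.+1) a (n - l)%N *: iter (n - l) p (c l)).
Proof.
move=> p1 cl; apply/fpsP => m.
pose g i l := (a i *: iter i p (c l)) m.
transitivity (\sum_(i < m.+1) \sum_(l < m.+1) g i l).
  apply: eq_bigr => i _; rewrite coeffZ.
  rewrite linear_coeff_fsum // ?scaler_sumr // => n x xn.
  by apply: in_adic_le (@raises_iter _ i p1 _ _ xn); rewrite leq_addl.
rewrite big_triangle => [|i l ltm].
  by apply: eq_bigr => n _; rewrite coeff_sum.
by rewrite /g (in_adicZ _ (@raises_iter _ i p1 _ _ (cl l))).
Qed.

End AdicSums.

(** * Exponentials, and the Fer identity for operator series *)

Section Exponential.
Variables (k : fieldType) (A : algType k).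
Implicit Types (u x y : fps A).

Lemma fps_exp_fsum x : in_adic 1 x ->
  fps_exp x = fsum (fun l => (l`!%:R)^-1 *: x ^+ l).
Proof.
by move=> x1; apply/adic_lim_unique/fsum_cvg => l; apply/in_adicZ/in_adicX.
Qed.

Lemma fps_exp_mulr x y : in_adic 1 x ->
  fps_exp x * y = fsum (fun l => (l`!%:R)^-1 *: iter l (x \*o idfun) y).
Proof.
move=> x1; have y0 : raises 0 (y \o* idfun) by apply: raises_mull.
rewrite fps_exp_fsum // -[LHS]/((y \o* idfun) (fsum _)) linear_fsum //.
  by apply: eq_fsum => l /=; rewrite -scalerAl iter_mulr.
by move=> l; apply/in_adicZ/in_adicX.
Qed.

Lemma iter_mull n x y : iter n (x \o* idfun) y = y * x ^+ n.
Proof. by elim: n => [|n /= ->]; rewrite ?mulr1 // exprSr mulrA. Qed.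

Lemma fps_exp_mull x y : in_adic 1 x ->
  y * fps_exp x = fsum (fun l => (l`!%:R)^-1 *: iter l (x \o* idfun) y).
Proof.
move=> x1; have y0 : raises 0 (y \*o idfun) by apply: raises_mulr.
rewrite fps_exp_fsum // -[LHS]/((y \*o idfun) (fsum _)) linear_fsum //.
  by apply: eq_fsum => l; rewrite iter_mull /= -scalerAr.
by move=> l; apply/in_adicZ/in_adicX.
Qed.

Lemma fps_exp_subr1 x : in_adic 1 x ->
  fps_exp x - 1 = fsum (fun l => (l.+1`!%:R)^-1 *: x ^+ l.+1).
Proof.
move=> x1; rewrite fps_exp_fsum // fsumS.
  by rewrite invr1 scale1r addrC addKr.
by move=> l; apply/in_adicZ/in_adicX.
Qed.

Lemma in_adic_exp n x : in_adic n.+1 x -> in_adic n.+1 (fps_exp x - 1).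
Proof.
move=> xn; rewrite fps_exp_subr1; last exact: in_adic_le xn.
apply: in_adic_fsum => l; apply: in_adicZ; rewrite exprS -[n.+1]addn0.
exact: in_adicM.
Qed.

Hypothesis pchar0 : [pchar k] =i pred0.

Lemma fact_neq0 n : n`!%:R != 0 :> k.
Proof. by move/pcharf0P: pchar0 => ->; rewrite -lt0n fact_gt0. Qed.

(** [fer_binomial] divided by (n+1)! and summed over n; characteristic zero permits the division. *)
Lemma fer_expansion (p q : {linear fps A -> fps A}) (D : fps A -> fps A) u :
    raises 1 p -> raises 1 q -> (forall x, p (q x) = q (p x)) ->
    (forall x, D x = q x - p x) ->
  fsum (fun n => (n`!%:R)^-1 *:
    iter n p (fsum (fun l => (l%:R / l.+1`!%:R) *: iter l D u))) +
  fsum (fun n => (n.+1`!%:R)^-1 *: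
    \sum_(i < n.+1) iter i p (iter (n - i) q u)) =
  fsum (fun n => (n`!%:R)^-1 *: iter n q u).
Proof.
move=> p1 q1 pq DE; have D1 : raises 1 D.
  by move=> m x xm; rewrite DE; apply/in_adicB; [apply: q1 | apply: p1].
rewrite (cauchy_fsum (fun n => (n`!%:R)^-1)) //; last first.
  move=> l; apply/in_adicZ.
  by have := @raises_iter _ _ _ l D1 0 u; rewrite addn0; apply.
rewrite fsumD; apply: eq_fsum => n.
have -> : (n`!%:R)^-1 *: iter n q u = (n.+1`!%:R)^-1 *: (iter n q u *+ n.+1).
  rewrite -scaler_nat scalerA; congr (_ *: _).
  have := fact_neq0 n.+1.
  rewrite factS natrM mulf_eq0 negb_or => /andP[n0 nf0].
  by rewrite invfM mulrAC mulVf // mul1r.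
rewrite -(fer_binomial pq DE) scalerDr [X in _ = X + _]scaler_sumr.
congr (_ + _).
have pZ m c x : iter m p (c *: x) = c *: iter m p x by apply: linearZ.
apply: eq_bigr => l _; rewrite pZ scalerA -scaler_nat scalerA.
congr (_ *: _); rewrite natrM.
have lel : (l.+1 <= n.+1)%N by apply: ltn_ord.
have := bin_fact lel; rewrite subSS; move: (l.+1)`! (n - l)`! => f g fg.
have := fact_neq0 n.+1; rewrite -fg !natrM; set C : k := 'C(_, _)%:R.
rewrite mulf_eq0 negb_or => /andP[C0 _].
rewrite [(C * _)^-1]invfM [RHS]mulrACA mulVf // mul1r invfM.
by rewrite mulrC [RHS]mulrC mulrA.
Qed.

End Exponential.

(** * The star product and one Fer step *)

Section Dendriform.
Variables (k : fieldType) (A : algType k) (pchar0 : [pchar k] =i pred0).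
Variables (r s : {linear fps A -> fps A}).
Hypotheses (r0 : raises 0 r) (s0 : raises 0 s).
Hypothesis rM : forall x y, r x * r y = r (r x * y + x * s y).
Hypothesis sM : forall x y, s x * s y = s (r x * y + x * s y).
Implicit Types (u v x y : fps A).

Definition star_ad u x := r u * x - x * s u.

Definition fer u : fps A := fsum (fun l =>
  ((-1) ^+ l * l%:R / l.+1`!%:R) *: iter l (star_ad u) u).

(* The (n+1)-st power of v for the associative product r x * y + x * s y;      *)
(* star_exp is the corresponding exponential minus 1.                          *)
Definition star_pow v n := \sum_(i < n.+1) r v ^+ i * v * s v ^+ (n - i).

Definition star_exp v : fps A :=
  fsum (fun n => (n.+1`!%:R)^-1 *: star_pow v n).

Lemma star_powS v n : star_pow v n.+1 = r v * star_pow v n + v * s v ^+ n.+1.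
Proof.
rewrite /star_pow big_ord_recl /= expr0 mul1r addrC; congr (_ + _).
rewrite mulr_sumr; apply: eq_bigr => i _.
by rewrite [bump 0 i]add1n exprS !mulrA subSS.
Qed.

(** By [sM], s sends star products to ordinary products, hence star powers to powers. *)
Lemma s_star_pow v n : s (star_pow v n) = s v ^+ n.+1.
Proof.
elim: n => [|n IHn]; first by rewrite /star_pow big_ord1 mulr1 mul1r.
by rewrite star_powS -IHn -sM IHn -exprS.
Qed.

Lemma r_star_pow v n : r (star_pow v n) = r v ^+ n.+1.
Proof.
elim: n => [|n IHn]; first by rewrite /star_pow big_ord1 mulr1 mul1r.
by rewrite star_powS -s_star_pow -rM IHn -exprS.
Qed.

Section Step.
Variable v : fps A.
Hypothesis v1 : in_adic 1 v.

Let rv1 : in_adic 1 (r v). Proof. exact: r0. Qed.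
Let sv1 : in_adic 1 (s v). Proof. exact: s0. Qed.

Lemma in_adic_star_pow n : in_adic n (star_pow v n).
Proof.
elim: n => [//|n IHn]; rewrite star_powS; apply: in_adicD.
  by rewrite -add1n; apply: in_adicM.
by apply: in_adic_le (in_adicM v1 (in_adicX sv1)); rewrite add1n.
Qed.

Lemma s_star_exp : s (star_exp v) = fps_exp (s v) - 1.
Proof.
rewrite fps_exp_subr1 // linear_fsum //.
  by apply: eq_fsum => n; rewrite /= linearZ /= s_star_pow.
by move=> l; apply/in_adicZ/in_adic_star_pow.
Qed.

Lemma r_star_exp : r (star_exp v) = fps_exp (r v) - 1.
Proof.
rewrite fps_exp_subr1 // linear_fsum //.
  by apply: eq_fsum => n; rewrite /= linearZ /= r_star_pow.
by move=> l; apply/in_adicZ/in_adic_star_pow.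
Qed.

End Step.

Section FerStep.
Variable v : fps A.
Hypothesis v1 : in_adic 1 v.

Let rv1 : in_adic 1 (r v). Proof. exact: r0. Qed.
Let sv1 : in_adic 1 (s v). Proof. exact: s0. Qed.

Lemma raises_star_ad : raises 1 (star_ad v).
Proof.
move=> m x xm; apply: in_adicB; first exact: in_adicM.
by rewrite addnC; apply: in_adicM.
Qed.

Lemma fer_ferE D : (forall x, D x = - star_ad v x) ->
  fsum (fun l => (l%:R / l.+1`!%:R) *: iter l D v) = fer v.
Proof.
move=> DE; apply: eq_fsum => l.
have -> : iter l D v = (-1) ^+ l *: iter l (star_ad v) v.
  elim: l => [|l IHl]; first by rewrite scale1r.
  rewrite !iterS IHl DE exprS mulN1r scaleNr /star_ad.
  by rewrite -scalerAr -scalerAl scalerBr.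
by rewrite scalerA mulrC mulrA.
Qed.

Lemma exp_mul_fer : fps_exp (r v) * fer v + star_exp v = v * fps_exp (s v).
Proof.
rewrite fps_exp_mulr // fps_exp_mull //.
pose D x := x * s v - r v * x.
have DE x : D x = - star_ad v x by rewrite /star_ad opprB.
rewrite -(fer_ferE DE)
  -(@fer_expansion _ _ pchar0 (r v \*o idfun) (s v \o* idfun) D) //.
- congr (_ + _); apply: eq_fsum => n; congr (_ *: _); apply: eq_bigr => i _.
  by rewrite iter_mull iter_mulr mulrA.
- exact: raises_mulr.
- exact: raises_mull.
- by move=> x /=; rewrite mulrA.
Qed.

Lemma fer_mul_exp :
  fer v * fps_exp (s (- v)) = fps_exp (r (- v)) * v + star_exp (- v).
Proof.
have rv1' : in_adic 1 (r (- v)) by apply/r0/in_adicN.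
have sv1' : in_adic 1 (s (- v)) by apply/s0/in_adicN.
rewrite fps_exp_mulr // fps_exp_mull //.
pose D x := r (- v) * x - x * s (- v).
have DE x : D x = - star_ad v x.
  by rewrite /D /star_ad !linearN /= mulNr mulrN opprB opprK addrC.
rewrite -(fer_ferE DE).
(* Here p is right multiplication by s (- v) and q is left multiplication by r (- v), so that D is
   again - [star_ad v]. *)
rewrite -(@fer_expansion _ _ pchar0
  (s (- v) \o* idfun) (r (- v) \*o idfun) D) //.
(* The divided difference contributed by [fer_expansion] is applied to v, whereas [star_exp (- v)]
   has - v in the middle. After reversing the index the two cancel. *)
- rewrite -addrA fsumD [X in _ + X](_ : _ = 0) ?addr0 //.
  apply/fpsP => m; apply: big1 => n _; rewrite -scalerDr.
  rewrite [X in _ *: X](_ : _ = 0) ?scaler0 //.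
  rewrite /star_pow [X in _ + X](reindex_inj rev_ord_inj) -big_split big1 //=.
  move=> i _; rewrite iter_mull iter_mulr subSS subKn ?leq_ord //.
  by rewrite mulrN mulNr subrr.
- exact: raises_mull.
- exact: raises_mulr.
- by move=> x /=; rewrite mulrA.
Qed.

(** The coefficient l kills the term l = 0, and every other term contains at least one [star_ad v],
    which raises the order. *)
Lemma in_adic_fer n : in_adic n.+1 v -> in_adic n.+2 (fer v).
Proof.
move=> vn; apply: in_adic_fsum => [[|l]]; first by rewrite mulr0 mul0r scale0r.
apply: in_adicZ.
apply: in_adic_le (@raises_iter _ _ _ l.+1 raises_star_ad _ _ vn).
by rewrite addSn ltnS leq_addl.
Qed.

Lemma X_defect x (e := x - 1 - s (fer v * x)) (E := fps_exp (s v)) :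
  E * x - 1 - s (v * (E * x)) = E * e - s (star_exp v * e).
Proof.
pose w := star_exp v; pose c := s (fer v * x).
have EE : E = 1 + s w by rewrite s_star_exp // addrC subrK.
have xE : x = 1 + c + e by rewrite /e addrC -[x - 1 - _]addrA -opprD subrK.
(* By [sM] the left side is s of r w * (fer v * x) + w * c. Then r w = exp (r v) - 1 and
   [exp_mul_fer] introduce v * E, and the equation for x eliminates w * c. *)
have wc : s w * c = s (v * (E * x)) - c - s w - s (w * e).
  rewrite sM r_star_exp // -/c -!linearB; congr (s _).
  have wx : w * x = w + w * c + w * e by rewrite {1}xE !mulrDr mulr1.
  rewrite mulrBl mul1r [v * _]mulrA -exp_mul_fer mulrDl -/w wx -mulrA !addrA.
  rewrite [RHS](ACl (1*5*3*(2*6)*(4*7)))%AC /=.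
  by rewrite !subrr !addr0.
have Ex : E * x = 1 + s w + (c + s w * c) + E * e.
  by rewrite [in LHS]xE 2!mulrDr mulr1 EE [X in _ + X + _ = _]mulrDl mul1r.
rewrite [in X in X - _ - _]Ex wc.
move: (E * e) (s (w * e)) (s (v * _)) (s w) => f g h d; rewrite !addrA.
rewrite [LHS](ACl ((1*9)*(2*6)*(3*5)*(4*10)*(8*7)))%AC /=.
by rewrite !subrr !add0r.
Qed.

Lemma Y_defect y (e := y - 1 + r (y * fer v)) (G := fps_exp (r (- v))) :
  y * G - 1 + r (y * G * v) = e * G - r (e * star_exp (- v)).
Proof.
pose w := star_exp (- v); pose c := r (y * fer v).
have v1' : in_adic 1 (- v) by apply: in_adicN.
have GE : G = 1 + r w by rewrite r_star_exp // addrC subrK.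
have yE : y = 1 - c + e by rewrite /e -/c addrC [1 - c]addrC addrA addrK subrK.
have cw : c * r w = r (y * G * v) - c + r w + r (e * w).
  rewrite rM s_star_exp // -/c -linearB -!linearD; congr (r _).
  have yw : y * w = w - c * w + e * w by rewrite {1}yE !mulrDl mulNr mul1r.
  rewrite mulrBr mulr1 -[_ * _ * fps_exp _]mulrA fer_mul_exp -/G -/w mulrDr yw.
  rewrite mulrA !addrA [LHS](ACl (2*6*3*5*(1*4)))%AC /=.
  by rewrite subrr addr0.
have yG : y * G = 1 + r w + e * G - c - c * r w.
  rewrite {1}yE mulrDl mulrBl mul1r {1 2}GE mulrDr mulr1 opprD !addrA.
  by rewrite [LHS](ACl (1*2*5*3*4))%AC.
rewrite {1}yG cw -/w.
move: (e * G) (r (e * w)) (r (y * G * v)) (r w) => f g h d.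
rewrite !opprD !opprK !addrA.
rewrite [LHS](ACl ((1*9)*(2*7)*(4*6)*(5*10)*3*8))%AC /=.
by rewrite !subrr !addNr !add0r.
Qed.

End FerStep.

(** * Order of the error of the partial products *)

Section Products.
Variable U : nat -> fps A.
Hypothesis U_adic : forall n, in_adic n.+1 (U n).
Hypothesis U_fer : forall n, U n.+1 = fer (U n).

Let U1 n : in_adic 1 (U n). Proof. exact: (in_adic_le _ (@U_adic n)). Qed.

Lemma X_prod_defect N j (P := \prod_(n <- iota j N) fps_exp (s (U n))) :
  in_adic (j + N).+1 (P - 1 - s (U j * P)).
Proof.
(* The start j varies: removing the factor of index j leaves a product that approximately solves the
   equation for U (j+1) = fer (U j). *)
rewrite /P; elim: N j {P} => [|N IHN] j.
  rewrite big_nil mulr1 subrr sub0r addn0; apply: in_adicN.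
  exact: (s0 (@U_adic j)).
rewrite /= big_cons X_defect // -U_fer addnS -addSn.
have e_adic := IHN j.+1; apply: in_adicB.
  by rewrite -[X in in_adic X]add0n; apply: in_adicM.
by apply: s0; rewrite -[X in in_adic X]add0n; apply: in_adicM.
Qed.

Lemma Y_prod_defect N j
    (P := \prod_(n <- rev (iota j N)) fps_exp (r (- U n))) :
  in_adic (j + N).+1 (P - 1 + r (P * U j)).
Proof.
rewrite /P; elim: N j {P} => [|N IHN] j.
  rewrite big_nil mul1r subrr add0r addn0.
  exact: (r0 (@U_adic j)).
rewrite /= rev_cons big_rcons Y_defect // -U_fer addnS -addSn.
have e_adic := IHN j.+1; apply: in_adicB.
  by rewrite -[X in in_adic X]addn0; apply: in_adicM.
by apply: r0; rewrite -[X in in_adic X]addn0; apply: in_adicM.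
Qed.

End Products.
End Dendriform.

(** * Convergence of the products and passage to the limit *)

Section Limits.
Variables (k : fieldType) (A : algType k).
Implicit Types (x : fps A) (P : nat -> fps A).

Lemma adic_cvg_lim P :
  (forall n, in_adic n (P n.+1 - P n)) -> adic_cvg P (adic_lim P).
Proof.
move=> PS; have cP := fsum_cvg PS.
apply: (@adic_limP _ _ (P 0%N + fsum (fun n => P n.+1 - P n))) => n.
have [N cN] := cP n; exists N => m leNm i ltin.
have := cN m leNm i ltin; rewrite telescope_sumr //.
by rewrite opprD addrA.
Qed.

Lemma adic_cvg_linear (T : {linear fps A -> fps A}) P x c :
    raises 0 T -> adic_cvg P x -> (forall n, in_adic n (T (P n) - c)) ->
  T x = c.
Proof.
move=> T0 Px Pc; apply: in_adic_eq => n; have [N Pn] := Px n.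
have Tn := T0 _ _ (Pn _ (leq_maxl N n)).
rewrite linearB in Tn.
have cn := in_adic_le (leq_maxr N n) (Pc (maxn N n)).
by have := in_adicB cn Tn; rewrite opprB addrC addrA subrK.
Qed.

(** Consecutive partial products differ by a multiple of exp (f n) - 1, whose order is at least n +
    1. *)
Lemma prod_exp_cvg (f : nat -> fps A) : (forall n, in_adic n.+1 (f n)) ->
  let P N := \prod_(n <- iota 0 N) fps_exp (f n) in adic_cvg P (adic_lim P).
Proof.
move=> f_adic P; apply: adic_cvg_lim => n.
rewrite /P -addn1 iotaD big_cat big_seq1 /= add0n.
rewrite -[X in _ - X]mulr1 -mulrBr -[X in in_adic X]add0n.
apply: in_adicM => //.
exact: (in_adic_le _ (in_adic_exp (f_adic n))).
Qed.

Lemma rev_prod_exp_cvg (f : nat -> fps A) : (forall n, in_adic n.+1 (f n)) ->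
  let P N := \prod_(n <- rev (iota 0 N)) fps_exp (f n) in
  adic_cvg P (adic_lim P).
Proof.
move=> f_adic P; apply: adic_cvg_lim => n.
rewrite /P -addn1 iotaD rev_cat big_cat big_seq1 /= add0n.
rewrite -[X in _ - X]mul1r -mulrBl -[X in in_adic X]addn0.
apply: in_adicM => //.
exact: (in_adic_le _ (in_adic_exp (f_adic n))).
Qed.

End Limits.

(** * Coefficientwise extension of linear maps; lambda is central *)

Section FpsMap.
Variables (k : fieldType) (A : algType k).
Implicit Types (u v : fps A).

Lemma fps_map_linear (f : {linear A -> A}) : linear (fps_map f).
Proof. by move=> c u v; apply/fpsP => n /=; rewrite linearP. Qed.

HB.instance Definition _ (f : {linear A -> A}) := GRing.isLinear.Build
  k (fps A) (fps A) *:%R (fps_map f) (fps_map_linear f).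

Lemma raises_fps_map (f : {linear A -> A}) : raises 0 (fps_map f).
Proof. by move=> m u um i ltim /=; rewrite um ?linear0. Qed.

Lemma lambdaM u n : (lambda A * u) n = if n is m.+1 then u m else 0.
Proof.
rewrite coeffM big_ord_recl mul0r add0r.
case: n => [|n]; first by rewrite big_ord0.
rewrite big_ord_recl mul1r /= subSS subn0 big1 ?addr0 // => i _.
by rewrite mul0r.
Qed.

Lemma lambda_comm u : u * lambda A = lambda A * u.
Proof.
apply/fpsP => n; rewrite lambdaM coeffM_rev big_ord_recl mulr0 add0r.
case: n => [|n]; first by rewrite big_ord0.
rewrite big_ord_recl mulr1 /= subSS subn0 big1 ?addr0 // => i _.
by rewrite mulr0.
Qed.

Lemma fps_map_lambda (f : {linear A -> A}) u :
  fps_map f (lambda A * u) = lambda A * fps_map f u.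
Proof.
apply/fpsP => n; rewrite lambdaM -[LHS]/(f _) lambdaM.
by case: n => //; rewrite linear0.
Qed.

End FpsMap.

(** * Rota-Baxter algebras as an instance of the star product setting *)

Section RotaBaxter.
Variables (k : fieldType) (A : algType k) (theta : k) (R : {linear A -> A}).
Hypothesis hR : rota_baxter theta R.
Implicit Types (u v : fps A).

Lemma RB_tilde_linear : linear (RB_tilde theta R).
Proof.
move=> c x y; rewrite /RB_tilde linearP scalerDr !scalerBr scalerN !scalerA.
rewrite mulrC !opprD !addrA; congr (_ + _).
by rewrite addrAC.
Qed.

HB.instance Definition _ := GRing.isLinear.Build
  k A A *:%R (RB_tilde theta R) RB_tilde_linear.


Definition RB_cotilde : {linear fps A -> fps A} :=
  \- fps_map (RB_tilde theta R).

Lemma RB_cotildeE u : RB_cotilde u = theta *: u + fps_map R u.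
Proof. by apply/fpsP => n; rewrite /= /RB_tilde opprB opprK addrC. Qed.

Lemma fps_rota_baxter u v :
  fps_map R u * fps_map R v =
  fps_map R (fps_map R u * v + u * fps_map R v + theta *: (u * v)).
Proof.
apply/fpsP => n; rewrite -[RHS]/(R ((_ + _ + _ : fps A) n)) !coeffD coeffZ.
rewrite !coeffM scaler_sumr -!big_split.
by rewrite linear_sum; apply: eq_bigr => i _; apply: hR.
Qed.

(** The weight term theta u v is absorbed into u S(v), since S = R + theta id. *)
Lemma fps_RM u v :
  fps_map R u * fps_map R v = fps_map R (fps_map R u * v + u * RB_cotilde v).
Proof.
rewrite fps_rota_baxter RB_cotildeE mulrDr scalerAr.
by rewrite [u * _ + u * _]addrC addrA.
Qed.

Lemma fps_SM u v :
  RB_cotilde u * RB_cotilde v =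
  RB_cotilde (fps_map R u * v + u * RB_cotilde v).
Proof.
rewrite [RHS]RB_cotildeE -fps_RM [RB_cotilde u]RB_cotildeE mulrDl.
rewrite {2}[RB_cotilde v]RB_cotildeE mulrDr scalerDr.
by rewrite -scalerAl -scalerAr addrCA addrA.
Qed.

Lemma raises_RB_cotilde : raises 0 RB_cotilde.
Proof. by move=> m u um; apply/in_adicN/raises_fps_map. Qed.

Lemma fer_stepE u : in_adic 1 u ->
  fer_step theta R u = fer (fps_map R) RB_cotilde u.
Proof.
move=> u1; apply: adic_lim_unique => n.
have adE : fps_prelie theta R u =1 star_ad (fps_map R) RB_cotilde u.
  move=> x; rewrite fps_prelieE /star_ad RB_cotildeE mulrDr -scalerAr.
  by rewrite opprD addrA addrAC.
have termE l : in_adic l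
    (((-1) ^+ l * l%:R / l.+1`!%:R) *:
      iter l (star_ad (fps_map R) RB_cotilde u) u).
  rewrite -(eq_iter adE).
  exact: (in_adic_le (leqnSn l) (fer_step_terms theta R u1)).
(* [N.+1] makes m positive, so the term l = 0, which is zero, can be split off to match the sum
   starting at 1. *)
have [N cN] := fsum_cvg termE n; exists N.+1 => m ltNm i ltin.
rewrite -(cN m (ltnW ltNm) i ltin) !coeffB; congr (_ - _).
rewrite [in RHS]big_ltn ?(leq_ltn_trans _ ltNm) //.
rewrite mulr0 mul0r scale0r add0r !coeff_sum; apply: eq_bigr => l _.
by rewrite (eq_iter adE).
Qed.

Lemma fer_U_in_adic a n : in_adic n.+1 (fer_U theta R a n).
Proof.
elim: n => [|n IHn] /=; first exact: (fer_U_adic theta R a 0).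
have u1 := fer_U_adic theta R a n.
rewrite fer_stepE //; apply: in_adic_fer => //; first exact: raises_fps_map.
exact: raises_RB_cotilde.
Qed.

End RotaBaxter.

Theorem corollary10 (k : fieldType) (pchar0 : [pchar k] =i pred0) (theta : k)
    (A : algType k) (R : {linear A -> A}) (hR : rota_baxter theta R) (a : A) :
  let X := Xhat theta R a in
  let Y := Yhat theta R a in
  [/\ adic_cvg (Xhat_part theta R a) X,
      X = 1 - lambda A * fps_map (RB_tilde theta R) (fpsC a * X),
      adic_cvg (Yhat_part theta R a) Y &
      Y = 1 - lambda A * fps_map R (Y * fpsC a)].
Proof.
move=> X Y; pose U := fer_U theta R a; pose S := RB_cotilde theta R.
have R0 := @raises_fps_map _ _ R; have S0 := @raises_RB_cotilde _ _ theta R.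
have U_adic n : in_adic n.+1 (U n) by apply: fer_U_in_adic.
have U_fer n : U n.+1 = fer (fps_map R) S (U n).
  by apply: fer_stepE; apply: fer_U_adic.
have RM := fps_RM hR; have SM := fps_SM hR.
have Xcvg : adic_cvg (Xhat_part theta R a) X.
  have := @prod_exp_cvg _ _ (fun n => S (U n)) (fun n => S0 _ _ (U_adic n)).
  rewrite /X /Xhat (_ : Xhat_part theta R a = fun N =>
    \prod_(n <- iota 0 N) fps_exp (S (U n))) //.
  by apply/boolp.funext => N; rewrite /Xhat_part /index_iota subn0.
have Ycvg : adic_cvg (Yhat_part theta R a) Y.
  have RU n : in_adic n.+1 (- fps_map R (U n)) by apply/in_adicN/R0.
  exact: rev_prod_exp_cvg RU.
split=> //.
- rewrite -fps_map_lambda mulrA.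
  (* The equation becomes T X = 1 with T linear and continuous, so the approximate solutions pass to
     the limit. *)
  pose T : {linear fps A -> fps A} := idfun \- (S \o (U 0 \*o idfun)).
  have T0 : raises 0 T.
    move=> m x xm; apply: in_adicB => //; apply: S0.
    by apply: (raises_mulr (m := 0)).
  have := adic_cvg_linear (c := 1) T0 Xcvg; rewrite /T /= opprK => TX.
  rewrite -[LHS](addrK (fps_map (RB_tilde theta R) (U 0 * X))) TX // => n.
  have := X_prod_defect (N := n) (j := 0) pchar0 R0 S0 RM SM U_adic U_fer.
  rewrite add0n addrAC => /(in_adic_le (leqnSn n)).
  by rewrite /Xhat_part /index_iota subn0.
- rewrite -fps_map_lambda mulrA -lambda_comm.
  pose T : {linear fps A -> fps A} := idfun \+ (fps_map R \o (U 0 \o* idfun)).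
  have T0 : raises 0 T.
    move=> m x xm; apply: in_adicD => //; apply: R0.
    by apply: (raises_mull (m := 0)).
  have := adic_cvg_linear (c := 1) T0 Ycvg; rewrite /T /= => TY.
  rewrite -mulrA -[LHS](addrK (fps_map R (Y * U 0))) TY // => n.
  have := Y_prod_defect (N := n) (j := 0) pchar0 R0 S0 RM SM U_adic U_fer.
  rewrite add0n addrAC => /(in_adic_le (leqnSn n)).
  by under eq_bigr do rewrite linearN.
Qed.
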